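(* Let $I$ be a finite set. (1) The Knit map $\mathbf{a}\mapsto \kappa_{\mathbf{a}}$ is a bijection between the set of all canonical p-sites over base $I$ and $\mathcal{P}(\mathcal{P}(I))$ (i.e. the set of all p-formations over base $I$), and its inverse is the canonical map $\mathcal{K}\mapsto \mathbf{ca}(I,\mathcal{K})$. (2) The Nerve map $\mathbf{a}\mapsto\sigma_{\mathbf{a}}$ is a bijection between the set of all perfect canonical p-sites over base $I$ and the set of all $I$-simplicial complexes, and its inverse is the canonical map $\mathcal{E}\mapsto \mathbf{ca}(I,\mathcal{E})$.
   Context: A p-site is a triple $\mathbf{a}=(I,A,(A_i)_{i\in I})$ with $I$ a finite set (the base), $A$ a set (the ground), and $A_i\subset A$ for each $i\in I$ (the profile). Its parting function is $\pi_{\mathbf{a}}:A\to\mathcal{P}(I)$, $\pi_{\mathbf{a}}(a)=\{i\in I: a\in A_i\}$. The Knit of $\mathbf{a}$ is $\kappa_{\mathbf{a}}=\{s\in\mathcal{P}(I): \exists a\in A,\ \pi_{\mathbf{a}}(a)=s\}$. The Nerve of $\mathbf{a}$ is $\sigma_{\mathbf{a}}=\{s\subset I: s\neq\emptyset,\ \exists a\in A,\ s\subset \pi_{\mathbf{a}}(a)\}$. A p-formation with base $I$ is a pair $(I,\mathcal{A})$ with $\mathcal{A}\subset\mathcal{P}(I)$. An $I$-simplicial complex is a set $\mathcal{E}$ of nonempty subsets of $I$ such that every nonempty subset of an element of $\mathcal{E}$ is in $\mathcal{E}$ (singletons of $I$ are not required to belong to $\mathcal{E}$, and $\mathcal{E}$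 may be empty). For $\mathcal{A}\subset\mathcal{P}(I)$, the canonical p-site $\mathbf{ca}(I,\mathcal{A})$ is the p-site with base $I$, ground $\mathcal{A}$ and profile $\mathcal{A}_i=\{s\in\mathcal{A}: i\in s\}$ ($i\in I$). A p-site with base $I$ is canonical if it equals $\mathbf{ca}(I,\mathcal{A})$ for some $\mathcal{A}\subset\mathcal{P}(I)$. A p-site $\mathbf{a}$ is perfect if $\kappa_{\mathbf{a}}=\sigma_{\mathbf{a}}$. *)

(* Defs.v *)
From mathcomp Require Import all_boot.
From mathcomp Require Import boolp classical_sets functions.

Set Implicit Arguments.
Unset Strict Implicit.
Unset Printing Implicit Defensive.

Local Open Scope classical_set_scope.

(* A p-site with base [I] whose ground is an arbitrary (classical, possibly
   infinite) set of elements of [U].  Equality of p-sites is equality of grounds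
   and of profiles, as sets. *)
Record psite (I : finType) (U : Type) := PSite {
  ground : set U;
  profile : I -> set U;
  profile_sub : forall i, profile i `<=` ground }.

(* Subsets of the finite set [I], and sets of such subsets, are MathComp finite
   sets (scope [%SET]); [`[< P >]] is the classical truth value of [P : Prop]. *)
Section PSites.
Variables (I : finType) (U : Type).
Implicit Type a : psite I U.

Definition pformation := {set {set I}}.

(* Meaningful for [x] in [ground a]. *)
Definition parting a (x : U) : {set I} := [set i | `[< profile a i x >]]%SET.

Definition knit a : pformation :=
  [set s : {set I} | `[< exists2 x, ground a x & parting a x = s >]]%SET.

Definition nerve a : pformation :=
  [set s : {set I} | (s != finset.set0) &&
    `[< exists2 x, ground a x & s \subset parting a x >]]%SET.

Definition perfect_psite : set (psite I U) := [set a | knit a = nerve a].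

End PSites.

Section Canonical.
Variable I : finType.
Implicit Types K E : pformation I.

Definition simplicial_complex : set (pformation I) :=
  [set E | (forall s, s \in E -> s != finset.set0) /\
    (forall s t : {set I},
       s \in E -> t \subset s -> t != finset.set0 -> t \in E)].

Definition ca_profile K (i : I) : set {set I} := [set s | s \in K /\ i \in s].

Lemma ca_profile_sub K i : ca_profile K i `<=` [set` K].
Proof. by move=> s []. Qed.

Definition ca K : psite I {set I} := PSite (@ca_profile_sub K).

(* The ground of a canonical p-site is a set of subsets of [I], so nothing is
   lost by fixing [U := {set I}] here. *)
Definition canonical_psite : set (psite I {set I}) := [set a | exists K, a = ca K].

End Canonical.

(* [g] maps [B] to [A] and, there, is inverse to [f] restricted to [A]. *)
Definition inverse_on (T T' : Type) (A : set T) (B : set T')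
    (f : T -> T') (g : T' -> T) : Prop :=
  [/\ set_fun B A g, forall x, A x -> g (f x) = x
    & forall y, B y -> f (g y) = y].

(* Main.v *)
Require Import Defs.
From mathcomp Require Import all_boot.
From mathcomp Require Import boolp classical_sets functions.

Local Open Scope classical_set_scope.

(* Over the canonical p-site [ca K] the parting function is the identity on [K],
   so the knit of [ca K] is [K], and its nerve consists of the nonempty subsets
   of elements of [K]; the latter is [K] itself exactly when [K] is a simplicial
   complex. *)

(** The left inverse law gives injectivity, the right one surjectivity. [inverse_on] only records
    that [g] maps [B] to [A], so the converse inclusion for [f] is a separate hypothesis. *)
Lemma inverse_on_bij {T T' : Type} {A : set T} {B : set T'}
    {f : T -> T'} {g : T' -> T} :
  set_fun A B f -> inverse_on A B f g -> set_bij A B f.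
Proof.
move=> fAB [gBA gK fK]; split=> // [x y|y By].
  by move=> /set_mem /gK {2}<- /set_mem /gK {2}<- ->.
by exists (g y); [exact: gBA|exact: fK].
Qed.

Lemma parting_ca (I : finType) (K : pformation I) (s : {set I}) :
  s \in K -> parting (ca K) s = s.
Proof.
move=> sK; apply/setP => i; rewrite inE.
by apply/asboolP/idP => [[]|].
Qed.

Lemma knit_ca (I : finType) (K : pformation I) : knit (ca K) = K.
Proof.
apply/setP => s; rewrite inE; apply/asboolP/idP => [[t tK <-]|sK].
  by rewrite parting_ca.
by exists s; rewrite ?parting_ca.
Qed.

(** A point of the ground witnessing [s] also witnesses every nonempty subset of [s]. *)
Lemma nerve_simplicial (I : finType) (U : Type) (a : psite I U) :
  simplicial_complex (nerve a).
Proof.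
split=> [s|s t]; rewrite inE => /andP[s0 /asboolP[x ax sx]] // ts t0.
rewrite inE t0 /=.
by apply/asboolP; exists x => //; exact: fintype.subset_trans ts sx.
Qed.

Lemma nerve_ca (I : finType) (K : pformation I) :
  simplicial_complex K -> nerve (ca K) = K.
Proof.
move=> [K0 Ksub]; apply/setP => s; rewrite inE.
apply/andP/idP => [[s0 /asboolP[t tK]]|sK].
  (* Downward closure carries membership in [K] from [t] to its nonempty subset [s]. *)
  by rewrite parting_ca // => st; exact: Ksub tK st s0.
split; first exact: K0.
by apply/asboolP; exists s; rewrite ?parting_ca.
Qed.

Theorem proposition2p5p13 (I : finType) :
  (set_bij (@canonical_psite I) [set: pformation I] (@knit I {set I}) /\
   inverse_on (@canonical_psite I) [set: pformation I]
     (@knit I {set I}) (@ca I)) /\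
  (set_bij (@perfect_psite I {set I} `&` @canonical_psite I)
     (@simplicial_complex I) (@nerve I {set I}) /\
   inverse_on (@perfect_psite I {set I} `&` @canonical_psite I)
     (@simplicial_complex I) (@nerve I {set I}) (@ca I)).
Proof.
have knit_inv : inverse_on (@canonical_psite I) [set: pformation I]
    (@knit I {set I}) (@ca I).
  split=> [K _|_ [K ->]|K _]; [by exists K|by rewrite knit_ca|exact: knit_ca].
have nerve_inv : inverse_on (@perfect_psite I {set I} `&` @canonical_psite I)
    (@simplicial_complex I) (@nerve I {set I}) (@ca I).
  split=> [K Ksc|a [perf [K aK]]|K Ksc]; last exact: nerve_ca.
    (* [ca K] is perfect because its knit and its nerve both equal [K]. *)
    by split; [rewrite /perfect_psite /= knit_ca nerve_ca|exists K].
  (* Perfectness replaces the nerve by the knit, which recovers [K] even though [K] is not known to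
     be a complex. *)
  by rewrite -perf aK knit_ca.
split; split=> //; first by apply: (inverse_on_bij _ knit_inv).
by apply: (inverse_on_bij _ nerve_inv) => a _; exact: nerve_simplicial.
Qed.
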